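(* Let $A\in\{\mathbb Z,\mathbb R\}$ and let $X\subset\mathbb R^d$ be a full-dimensional polytope. Then every convex body $K\subset\mathbb R^d$ which is $A$-$X$-free and inclusion-maximal among $A$-$X$-free convex bodies is a polytope.
   Context: A convex body in $\mathbb R^d$ is a nonempty compact convex subset of $\mathbb R^d$. An $A$-unimodular transformation is a map $T:\mathbb R^d\to\mathbb R^d$, $T(x)=Mx+b$ with $M\in \mathrm{GL}_d(\mathbb Z)$ and $b\in A^d$; an $A$-unimodular copy of $X\subset\mathbb R^d$ is a set $T(X)$ for such a $T$. A convex set $K\subset\mathbb R^d$ is called $A$-$X$-free if the relative interior of $K$ contains no $A$-unimodular copy of $X$ (by convention the relative interior of a single point is that point). *)

(* Defs.v *)
From HB Require Import structures.
From mathcomp Require Import all_boot all_order all_algebra.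
From mathcomp Require Import all_classical all_reals all_analysis.
Set Implicit Arguments. Unset Strict Implicit. Unset Printing Implicit Defensive.
Import Order.TTheory GRing.Theory Num.Theory.
Import numFieldNormedType.Exports.
Local Open Scope classical_set_scope.
Local Open Scope ring_scope.

Inductive coeffA := AZ | AR.

Definition inA {R : realType} (A : coeffA) (x : R) : bool :=
  match A with AZ => x \is a Num.int | AR => true end.

Section Defs.
Variables (R : realType) (d : nat).
Notation pt := 'cV[R]_d.

Definition convex_set (K : set pt) : Prop :=
  forall x y t, K x -> K y -> 0 <= t <= 1 -> K ((1 - t) *: x + t *: y).

Definition convex_body (K : set pt) : Prop :=
  K !=set0 /\ compact K /\ convex_set K.

Definition conv_seq (s : seq pt) : set pt :=
  [set x | exists w : 'I_(size s) -> R,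
     (forall i, 0 <= w i) /\ \sum_(i < size s) w i = 1 /\
     x = \sum_(i < size s) w i *: s`_i].

Definition polytope (K : set pt) : Prop :=
  exists s : seq pt, (0 < size s)%N /\ K = conv_seq s.

Definition aff_hull (K : set pt) : set pt :=
  [set x | exists (n : nat) (p : 'I_n -> pt) (w : 'I_n -> R),
     (forall i, K (p i)) /\ \sum_(i < n) w i = 1 /\
     x = \sum_(i < n) w i *: p i].

Definition full_dimensional (K : set pt) : Prop := aff_hull K = setT.

(* relative interior: points of K having a neighbourhood within aff K
   contained in K (for a singleton this gives the point itself) *)
Definition relint (K : set pt) : set pt :=
  [set x | K x /\ exists e : R, 0 < e /\ ball x e `&` aff_hull K `<=` K].

Definition unimodular_map (A : coeffA) (T : pt -> pt) : Prop :=
  exists (M : 'M[int]_d) (b : pt),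
    M \in unitmx /\ (forall i j, inA A (b i j)) /\
    forall x, T x = map_mx (fun z : int => z%:~R) M *m x + b.

Definition unimodular_copy (A : coeffA) (X Y : set pt) : Prop :=
  exists T, unimodular_map A T /\ Y = T @` X.

Definition AX_free (A : coeffA) (X K : set pt) : Prop :=
  ~ exists Y, unimodular_copy A X Y /\ Y `<=` relint K.

Definition maximal_AX_free_body (A : coeffA) (X K : set pt) : Prop :=
  convex_body K /\ AX_free A X K /\
  forall L, convex_body L -> AX_free A X L -> K `<=` L -> L = K.

End Defs.

(* Main.v *)
(* Let K be a maximal free body.  If K has empty interior, so has its double
   about any of its points, which is therefore free as well: then K is a point.
   Otherwise enclose K in a polytope.  Since X is full-dimensional, the copies
   of X inside that polytope have only finitely many linear parts (and, over Z,
   finitely many translation parts).  For each of these finitely many classes,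
   separation from the interior of K gives finitely many half-spaces containing
   K such that every copy of the class has a point outside the interior of one
   of them.  Cutting the polytope by all these half-spaces yields a free
   polytope containing K, hence equal to K by maximality. *)

Require Import Defs.
From mathcomp Require Import all_boot all_order all_algebra.
From mathcomp Require Import all_classical all_reals all_analysis.
From mathcomp Require Import ring lra zify.
(* Re-imported last: [convex_set] is also a name of the analysis library. *)
Import Defs.

Set Implicit Arguments.
Unset Strict Implicit.
Unset Printing Implicit Defensive.
Import Order.TTheory GRing.Theory Num.Theory numFieldNormedType.Exports.
Local Open Scope classical_set_scope.
Local Open Scope ring_scope.

(** * Convex combinations and convex hulls of finite sequences *)

Lemma continuous_sum (R : realType) (T : topologicalType) (V : normedModType R)
    (I : Type) (r : seq I) (f : I -> T -> V) :
  (forall i, continuous (f i)) -> continuous (fun x => \sum_(i <- r) f i x).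
Proof.
move=> cf; elim: r => [|i r IH].
  under [X in continuous X]eq_fun do rewrite big_nil.
  by move=> x; exact: cvg_cst.
under [X in continuous X]eq_fun do rewrite big_cons.
by move=> x; apply: cvgD; [exact: cf | exact: IH].
Qed.

Section ConvexSum.
Variables (R : realType) (d : nat).
Notation pt := 'cV[R]_d.
Implicit Types (C K : set pt) (s : seq pt).

(** Induction on normalised partial sums reduces this to the two-point definition of convexity.
    Points of zero weight are left unconstrained, so that sums indexed by all pairs of vertices can
    be handled even though only some pairs yield points of [C]. *)
Lemma convex_sum C (I : finType) (w : I -> R) (p : I -> pt) :
  convex_set C -> (forall i, 0 <= w i) -> \sum_i w i = 1 ->
  (forall i, 0 < w i -> C (p i)) -> C (\sum_i w i *: p i).
Proof.
move=> cC w0 w1 Cp.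
suff H (r : seq I) : 0 < \sum_(i <- r) w i ->
    C ((\sum_(i <- r) w i)^-1 *: \sum_(i <- r) w i *: p i).
  by have := H (index_enum I); rewrite w1 invr1 scale1r => /(_ ltr01).
elim: r => [|a r IH]; first by rewrite big_nil ltxx.
rewrite !big_cons; set S := \sum_(i <- r) w i in IH *.
have S0 : 0 <= S by apply: sumr_ge0.
(* If the tail has total weight zero, its terms all vanish and only [p a] remains; otherwise the
   tail can be normalised. *)
have [Sz|SN0] := eqVneq S 0.
  have -> : \sum_(i <- r) w i *: p i = 0.
    apply: big1_seq => i /andP[_ ir].
    move/eqP: Sz; rewrite psumr_eq0 // => /allP /(_ i ir) /eqP ->.
    by rewrite scale0r.
  rewrite Sz !addr0 => wa; rewrite scalerA mulVf ?gt_eqF// scale1r.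
  exact: Cp.
have Sp : 0 < S by rewrite lt0r SN0.
have [-> _|waN0] := eqVneq (w a) 0; first by rewrite scale0r !add0r; apply: IH.
have wa : 0 < w a by rewrite lt0r waN0 w0.
move=> Tp.
have := cC _ _ (S / (w a + S)) (Cp _ wa) (IH Sp).
have TN0 : w a + S != 0 by rewrite gt_eqF.
have -> : 1 - S / (w a + S) = (w a + S)^-1 * w a by field.
rewrite !scalerA scalerDr scalerA.
have -> : S / (w a + S) / S = (w a + S)^-1 by field; rewrite TN0 SN0.
apply; apply/andP; split; first by rewrite divr_ge0// ltW.
by rewrite ler_pdivrMr// mul1r lerDr ltW.
Qed.

Lemma convex_conv_seq s : convex_set (conv_seq s).
Proof.
move=> _ _ t [w [w0 [w1 ->]]] [v [v0 [v1 ->]]] /andP[t0 t1].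
exists (fun i => (1 - t) * w i + t * v i); split; last split.
- by move=> i; rewrite addr_ge0 ?mulr_ge0 ?subr_ge0.
- by rewrite big_split/= -!mulr_sumr w1 v1 !mulr1 subrK.
- rewrite !scaler_sumr -big_split/=; apply: eq_bigr => i _.
  by rewrite [RHS]scalerDl !scalerA.
Qed.

Lemma conv_seq_mem s x : x \in s -> conv_seq s x.
Proof.
move=> xs; have i0 : (index x s < size s)%N by rewrite index_mem.
exists (fun i => (i == Ordinal i0)%:R); split; last split.
- by move=> i; rewrite ler0n.
- by rewrite (bigD1 (Ordinal i0))//= eqxx big1 ?addr0// => i /negbTE ->.
- rewrite (bigD1 (Ordinal i0))//= eqxx scale1r nth_index// big1 ?addr0//.
  by move=> i /negbTE ->; rewrite scale0r.
Qed.

Lemma conv_seq_sub C s :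
  convex_set C -> (forall x, x \in s -> C x) -> conv_seq s `<=` C.
Proof.
move=> cC sC _ [w [w0 [w1 ->]]]; apply: convex_sum => // i _.
by apply: sC; apply: mem_nth.
Qed.

Lemma compact_conv_seq s : compact (conv_seq s).
Proof.
pose n := size s.
(* [W] is the standard simplex, a closed part of a cube; the hull is its image under a continuous
   map. *)
pose W := [set w : 'rV[R]_n | forall i, `[0, 1]%classic (w ord0 i)] `&`
          [set w : 'rV[R]_n | \sum_i w ord0 i = 1].
have cW : compact W.
  apply: compact_closedI.
    have := @rV_compact R n (fun=> `[0, 1]%classic) (fun=> @segment_compact R 0 1).
    exact.
  have -> : [set w : 'rV[R]_n | \sum_i w ord0 i = 1] =
      (fun w : 'rV[R]_n => \sum_i w ord0 i) @^-1` [set 1] by [].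
  apply: preimage_closed; last exact: closed_eq.
  move=> w _; have := @continuous_sum R 'rV[R]_n R^o 'I_n (index_enum _)
    (fun i w => w ord0 i) (fun i => @coord_continuous R 1 n ord0 i).
  exact.
have -> : conv_seq s = (fun w : 'rV[R]_n => \sum_i w ord0 i *: s`_i) @` W.
  apply/seteqP; split => [_ [w [w0 [w1 ->]]]|_ [w [w0 w1] <-]].
    exists (\row_i w i); last by apply: eq_bigr => i _; rewrite mxE.
    split=> /= [i|]; last by rewrite -w1; apply: eq_bigr => i _; rewrite mxE.
    rewrite mxE in_itv/= w0 -w1 (bigD1 i)//= lerDl.
    exact: sumr_ge0.
  exists (fun i => w ord0 i); split=> // i.
  by have := w0 i; rewrite /= in_itv/= => /andP[].
apply: continuous_compact => //; apply: continuous_subspaceT.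
have := @continuous_sum R 'rV[R]_n pt 'I_n (index_enum _)
  (fun i w => w ord0 i *: s`_i).
apply=> i w.
exact: (cvgZr_tmp (a := s`_i) (@coord_continuous R 1 n ord0 i w)).
Qed.

End ConvexSum.

(** * Cutting a polytope by half-spaces *)

Section Halfspaces.
Variable R : realType.
Implicit Types d : nat.

Definition dot d (u : 'rV[R]_d) (x : 'cV[R]_d) : R := (u *m x) 0 0.

Lemma dotE d (u : 'rV[R]_d) x : dot u x = \sum_i u 0 i * x i 0.
Proof. by rewrite /dot mxE. Qed.

Lemma dotDr d (u : 'rV[R]_d) x y : dot u (x + y) = dot u x + dot u y.
Proof. by rewrite /dot mulmxDr mxE. Qed.

Lemma dotZr d (u : 'rV[R]_d) a x : dot u (a *: x) = a * dot u x.
Proof. by rewrite /dot -scalemxAr mxE. Qed.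

Lemma dotBr d (u : 'rV[R]_d) x y : dot u (x - y) = dot u x - dot u y.
Proof. by rewrite -scaleN1r dotDr dotZr mulN1r. Qed.

Lemma dot_sumr d (u : 'rV[R]_d) (I : finType) (x : I -> 'cV[R]_d) :
  dot u (\sum_i x i) = \sum_i dot u (x i).
Proof. by rewrite /dot mulmx_sumr summxE. Qed.

Lemma dot_trmx_gt0 d (u : 'rV[R]_d) : u != 0 -> 0 < dot u u^T.
Proof.
move=> u0; rewrite dotE lt0r sumr_ge0 ?andbT; last first.
  by move=> i _; rewrite mxE -expr2 sqr_ge0.
apply: contra u0; rewrite psumr_eq0 => [/allP u0|i _]; last first.
  by rewrite mxE -expr2 sqr_ge0.
apply/eqP/matrixP => a i; rewrite ord1 mxE.
by have := u0 i (mem_index_enum i); rewrite mxE mulf_eq0 orbb => /eqP.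
Qed.

Lemma convex_halfspace d (u : 'rV[R]_d) (c : R) :
  convex_set [set x | c <= dot u x].
Proof.
move=> x y t /= cx cy /andP[t0 t1]; rewrite dotDr !dotZr.
have : (1 - t) * c <= (1 - t) * dot u x by rewrite ler_wpM2l// subr_ge0.
have : t * c <= t * dot u y by rewrite ler_wpM2l.
lra.
Qed.

Lemma convex_setI d (A B : set 'cV[R]_d) :
  convex_set A -> convex_set B -> convex_set (A `&` B).
Proof. by move=> cA cB x y t [Ax Bx] [Ay By] t01; split; [apply: cA|apply: cB]. Qed.

(* The mass of the points with [a i < 0] is moved onto the points where the
   hyperplane [a = 0] meets the segments joining the two sides. *)
Lemma split_across (V : lmodType R) (I : finType) (w a : I -> R) (q : I -> V) :
  let A := \sum_(i | 0 <= a i) w i * a i in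
  let B := \sum_(i | ~~ (0 <= a i)) w i * - a i in
  A != 0 ->
  \sum_i w i *: q i =
  \sum_(p : I * I) (if (0 <= a p.1) && ~~ (0 <= a p.2)
                    then w p.1 * w p.2 / A else 0) *:
     (- a p.2 *: q p.1 + a p.1 *: q p.2) +
  \sum_i (if 0 <= a i then w i * (1 - B / A) else 0) *: q i.
Proof.
move=> A B A0.
have -> : \sum_(p : I * I) (if (0 <= a p.1) && ~~ (0 <= a p.2)
                    then w p.1 * w p.2 / A else 0) *:
     (- a p.2 *: q p.1 + a p.1 *: q p.2) =
   \sum_(i | 0 <= a i) \sum_(j | ~~ (0 <= a j))
     (w i * w j / A) *: (- a j *: q i + a i *: q j).
  rewrite pair_big/= [RHS]big_mkcond/=; apply: eq_bigr => p _.
  by case: ifP => // _; rewrite scale0r.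
have -> : \sum_i (if 0 <= a i then w i * (1 - B / A) else 0) *: q i =
    \sum_(i | 0 <= a i) (w i * (1 - B / A)) *: q i.
  rewrite [RHS]big_mkcond/=; apply: eq_bigr => p _.
  by case: ifP => // _; rewrite scale0r.
have -> : \sum_(i | 0 <= a i) \sum_(j | ~~ (0 <= a j))
     (w i * w j / A) *: (- a j *: q i + a i *: q j) =
   \sum_(i | 0 <= a i) (w i * (B / A)) *: q i +
   \sum_(j | ~~ (0 <= a j)) w j *: q j.
  under eq_bigr do under eq_bigr do rewrite scalerDr !scalerA.
  under eq_bigr do rewrite big_split/=.
  rewrite big_split/=; congr +%R.
    apply: eq_bigr => i _; rewrite -scaler_suml; congr (_ *: _).
    rewrite /B mulr_suml mulr_sumr; apply: eq_bigr => j _; by field.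
  rewrite exchange_big/=; apply: eq_bigr => j _.
  rewrite -scaler_suml; congr (_ *: _).
  rewrite -[RHS](mulfK A0) {2}/A.
  by rewrite mulr_sumr mulr_suml; apply: eq_bigr => i _; by field.
rewrite (bigID (fun i => 0 <= a i))/= addrAC -big_split/=; congr (_ + _).
by apply: eq_bigr => i _; rewrite -scalerDl; congr (_ *: _); ring.
Qed.

(** The cut is spanned by the given points inside the half-space together with the points [f x y]
    where a segment from an inside point to an outside point crosses the bounding hyperplane. The
    new sequence may be empty, since the half-space may miss the hull. *)
Lemma conv_seq_halfspace d (s : seq 'cV[R]_d) (u : 'rV[R]_d) (c : R) :
  exists s', conv_seq s `&` [set x | c <= dot u x] = conv_seq s'.
Proof.
pose h x := dot u x - c.
pose ins := [seq x <- s | 0 <= h x]; pose outs := [seq x <- s | ~~ (0 <= h x)].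
pose f x y := (h x - h y)^-1 *: (- h y *: x + h x *: y).
exists (ins ++ [seq f x y | x <- ins, y <- outs]).
apply/seteqP; split; last first.
  apply: conv_seq_sub.
    by apply: convex_setI; [exact: convex_conv_seq|exact: convex_halfspace].
  move=> z; rewrite mem_cat => /orP[|/allpairsP[[x y]/= []]].
    rewrite mem_filter => /andP[hz zs]; split; first exact: conv_seq_mem.
    by rewrite /= -subr_ge0.
  rewrite !mem_filter -ltNge => /andP[hx xs] /andP[hy ys] ->.
  have hxy : 0 < h x - h y by rewrite subr_gt0 (lt_le_trans hy).
  split.
    have -> : f x y = (1 - h x / (h x - h y)) *: x + h x / (h x - h y) *: y.
      rewrite /f scalerDr !scalerA; congr (_ *: _ + _ *: _); last by rewrite mulrC.
      by field; rewrite gt_eqF.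
    apply: convex_conv_seq; [exact: conv_seq_mem|exact: conv_seq_mem|].
    apply/andP; split; first by rewrite divr_ge0// ltW.
    by rewrite ler_pdivrMr// mul1r lerBrDr gerDl ltW.
  rewrite /= /f dotZr dotDr !dotZr.
  have -> : - h y * dot u x + h x * dot u y = (h x - h y) * c by rewrite /h; ring.
  by rewrite mulrA mulVf ?mul1r// gt_eqF.
set s' := ins ++ _.
move=> _ [[w [w0 [w1 ->]]] /= cx].
have ms (i : 'I_(size s)) : s`_i \in s by exact: mem_nth.
pose a (i : 'I_(size s)) := h s`_i.
have sa : 0 <= \sum_i w i * a i.
  under eq_bigr do rewrite mulrBr.
  rewrite sumrB -mulr_suml w1 mul1r subr_ge0 (le_trans cx)// dot_sumr.
  by rewrite le_eqVlt; apply/orP; left; apply/eqP/eq_bigr => i _; rewrite dotZr.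
have ins' (i : 'I_(size s)) : 0 <= a i -> conv_seq s' s`_i.
  move=> ai; apply: conv_seq_mem; rewrite mem_cat mem_filter -/(a i) ai ms//.
have cs' := @convex_conv_seq R d s'.
pose A := \sum_(i | 0 <= a i) w i * a i.
pose B := \sum_(i | ~~ (0 <= a i)) w i * - a i.
have AB : B <= A.
  rewrite -subr_ge0 (le_trans sa)// (bigID (fun i => 0 <= a i))/= lerD2l.
  by rewrite /B -sumrN; apply: ler_sum => i _; rewrite mulrN opprK.
have B0 : 0 <= B.
  apply: sumr_ge0 => i; rewrite -ltNge => ai.
  by rewrite mulr_ge0// oppr_ge0 ltW.
(* When [B = 0] no outside point carries weight. Otherwise [A >= B > 0], so division by [A] is
   legitimate. *)
have [Bz|BN0] := eqVneq B 0.
  apply: convex_sum => // i wi; apply: ins'; apply: contraT => ai.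
  have := psumr_eq0P _ Bz; move=> /(_ _ i ai) H.
  suff : w i * - a i = 0.
    move/eqP; rewrite mulf_eq0 oppr_eq0 => /orP[]/eqP E.
      by rewrite E ltxx in wi.
    by rewrite E lexx in ai.
  apply: H => j aj; rewrite mulr_ge0// oppr_ge0 ltW//.
  by rewrite -ltNge in aj.
have A0 : 0 < A by rewrite (lt_le_trans _ AB)// lt0r BN0.
have AN0 : A != 0 by rewrite gt_eqF.
pose lam (p : 'I_(size s) * 'I_(size s)) :=
  if (0 <= a p.1) && ~~ (0 <= a p.2) then w p.1 * w p.2 / A else 0.
pose mu i := if 0 <= a i then w i * (1 - B / A) else 0.
(* The factor [a p.1 - a p.2] compensates for the normalisation built into [f]. *)
pose W (k : 'I_(size s) * 'I_(size s) + 'I_(size s)) :=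
  match k with inl p => lam p * (a p.1 - a p.2) | inr i => mu i end.
pose P (k : 'I_(size s) * 'I_(size s) + 'I_(size s)) :=
  match k with inl p => f s`_p.1 s`_p.2 | inr i => s`_i end.
have lamP p : lam p != 0 -> 0 <= a p.1 /\ a p.2 < 0.
  by rewrite /lam ltNge; case: ifP => [/andP[]|]; rewrite ?eqxx.
have -> : \sum_i w i *: s`_i = \sum_k W k *: P k.
  rewrite (@split_across _ _ w a _ AN0) big_sumType/=; congr +%R.
  apply: eq_bigr => p _; rewrite -/(lam p).
  have [->|/lamP[a1 a2]] := eqVneq (lam p) 0; first by rewrite mul0r !scale0r.
  rewrite /f scalerA mulfK// gt_eqF// subr_gt0.
  exact: lt_le_trans a2 a1.
apply: convex_sum => //.
- case=> [p|i] /=.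
    have [->|] := eqVneq (lam p) 0; first by rewrite mul0r.
    move=> /lamP[a1 a2]; rewrite /lam a1 -ltNge a2/=.
    by rewrite !mulr_ge0// ?invr_ge0 ?(ltW A0)// subr_ge0 (le_trans _ a1)// ltW.
  rewrite /mu; case: ifP => // _; rewrite mulr_ge0// subr_ge0.
  by rewrite ler_pdivrMr// mul1r.
- rewrite big_sumType/= -[RHS]w1.
  (* The total weight is read off the same splitting identity, applied to the constant family 1 in
     the module [R^o]. *)
  have -> : \sum_i w i = \sum_i w i *: (1 : R^o).
    by apply: eq_bigr => i _; rewrite /GRing.scale/= mulr1.
  rewrite (@split_across R^o _ w a (fun=> 1) AN0).
  congr +%R; apply: eq_bigr => p _; rewrite /GRing.scale/= !mulr1//.
  by rewrite addrC.
- case=> [p|i] /=.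
    have [->|] := eqVneq (lam p) 0; first by rewrite mul0r ltxx.
    move=> /lamP[a1 a2] _; apply: conv_seq_mem.
    rewrite mem_cat; apply/orP; right; apply/allpairsP.
    exists (s`_p.1, s`_p.2) => /=.
    by rewrite !mem_filter !ms !andbT -ltNge.
  by rewrite /mu; case: ifP => [ai _|]; [exact: ins'|rewrite ltxx].
Qed.

Lemma conv_seq_halfspaces d (s : seq 'cV[R]_d) (G : seq ('rV[R]_d * R)) :
  exists s', conv_seq s `&` [set x | forall g, g \in G -> g.2 <= dot g.1 x] =
    conv_seq s'.
Proof.
elim: G => [|[u c] G [s' IH]].
  exists s; apply/seteqP; split=> [x []//|x sx]; by split.
have [s2 E] := conv_seq_halfspace s' u c; exists s2.
rewrite -E -IH; apply/seteqP; split=> x.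
  move=> [sx Gx]; split; last by apply: (Gx (u, c)); rewrite mem_head.
  by split=> //= g gG; apply: Gx; rewrite in_cons gG orbT.
move=> [[sx Gx] cx]; split=> //= g; rewrite in_cons => /orP[/eqP->//|].
exact: Gx.
Qed.

End Halfspaces.

(** * Separation of convex sets *)

Section Separation.
Variable R : realType.

(** Induction on the dimension, in the manner of Hahn-Banach: a functional [v] nonnegative on the
    slice [t = 0] is extended by a coefficient of [t], which must lie between the lower bounds from
    the points with [t > 0] and the upper bounds from those with [t < 0]. No closedness is assumed,
    so the inequality obtained is not strict. *)
Lemma weak_separation m (C : set 'cV[R]_m) :
  convex_set C -> C !=set0 -> ~ C 0 ->
  exists u : 'rV[R]_m, u != 0 /\ forall x, C x -> 0 <= dot u x.
Proof.
elim: m C => [|m IH] C cC [x0 Cx0] C0.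
  by case: C0; rewrite (_ : 0 = x0)//; apply/matrixP => -[].
pose t (x : 'cV[R]_(1 + m)) := usubmx x 0 0.
pose D (x : 'cV[R]_(1 + m)) := dsubmx x.
pose F a (v : 'rV[R]_m) : 'rV[R]_(1 + m) := row_mx a%:M v.
have dotF a v x : dot (F a v) x = a * t x + dot v (D x).
  by rewrite /dot -[x in LHS]vsubmxK mul_row_col mul_scalar_mx [LHS]mxE [X in X + _]mxE.
have F0 a v : (a != 0) || (v != 0) -> F a v != 0.
  move=> av; apply/eqP => E; move: av.
  have -> : v = 0 by rewrite -(row_mxKr a%:M v) -/(F a v) E linear0.
  suff -> : a = 0 by rewrite !eqxx.
  have : lsubmx (F a v) = 0 by rewrite E linear0.
  by rewrite row_mxKl => /matrixP /(_ 0 0); rewrite !mxE eqxx.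
(* If the first coordinate keeps one sign on [C], that coordinate or its opposite already
   separates. *)
have [[xp [Cp tp]]|np] := pselect (exists x, C x /\ 0 < t x); last first.
  exists (F (-1) 0); split=> [|x Cx]; first by rewrite F0// oppr_eq0 oner_eq0.
  rewrite dotF /dot mul0mx mxE addr0 mulN1r oppr_ge0 leNgt; apply/negP => tx.
  by apply: np; exists x.
have [[xn [Cn tn]]|nn] := pselect (exists x, C x /\ t x < 0); last first.
  exists (F 1 0); split=> [|x Cx]; first by rewrite F0// oner_eq0.
  rewrite dotF /dot mul0mx mxE addr0 mul1r leNgt; apply/negP => tx.
  by apply: nn; exists x.
pose C' := [set y : 'cV[R]_m | C (col_mx (0 : 'cV[R]_1) y)].
have tDE x : t x = 0 -> col_mx (0 : 'cV[R]_1) (D x) = x.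
  move=> tx; rewrite -[RHS]vsubmxK; congr col_mx.
  by apply/matrixP => i j; rewrite !ord1 mxE -tx.
have slice x y : C x -> C y -> 0 < t x -> t y < 0 ->
    let s := t x / (t x - t y) in C' ((1 - s) *: D x + s *: D y).
  move=> Cx Cy tx ty s.
  have dxy : 0 < t x - t y by rewrite subr_gt0 (lt_trans ty).
  have -> : (1 - s) *: D x + s *: D y = D ((1 - s) *: x + s *: y).
    by rewrite /D linearD !linearZ.
  rewrite /C' /= tDE.
    apply: cC => //; apply/andP; split; first by rewrite divr_ge0// ltW.
    by rewrite ler_pdivrMr// mul1r lerBrDr gerDl ltW.
  have -> : t ((1 - s) *: x + s *: y) = (1 - s) * t x + s * t y.
    by rewrite /t !mxE.
  by rewrite /s; field; rewrite gt_eqF.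
have [|||v [v0 vC]] := IH C'.
- move=> x y s Cx Cy s01; rewrite /C' /=.
  have -> : col_mx (0 : 'cV[R]_1) ((1 - s) *: x + s *: y) =
      (1 - s) *: col_mx 0 x + s *: col_mx 0 y.
    by rewrite !scale_col_mx add_col_mx !scaler0 addr0.
  exact: cC.
- by eexists; exact: slice Cp Cn tp tn.
- by rewrite /C' /= col_mx0.
(* Every lower bound is at most every upper bound, because the segment from [x] to [y] meets the
   slice, where [v] is nonnegative. The supremum of the lower bounds is therefore an admissible
   coefficient. *)
have key x y : C x -> C y -> 0 < t x -> t y < 0 ->
    - dot v (D x) / t x <= dot v (D y) / - t y.
  move=> Cx Cy tx ty; have := vC _ (slice _ _ Cx Cy tx ty).
  have dxy : 0 < t x - t y by rewrite subr_gt0 (lt_trans ty).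
  have ny : 0 < - t y by rewrite oppr_gt0.
  rewrite dotDr !dotZr => H.
  rewrite ler_pdivrMr// mulrAC ler_pdivlMr//.
  have : (t x - t y) * ((1 - t x / (t x - t y)) * dot v (D x) +
     t x / (t x - t y) * dot v (D y)) = - t y * dot v (D x) + t x * dot v (D y).
    by field; rewrite gt_eqF.
  have := mulr_ge0 (ltW dxy) H.
  by move=> /[swap] ->; lra.
pose S := [set - dot v (D x) / t x | x in [set x | C x /\ 0 < t x]].
have S0 : S !=set0 by exists (- dot v (D xp) / t xp); exists xp.
have hS : has_sup S.
  split=> //; exists (dot v (D xn) / - t xn) => _ [x [Cx tx] <-]; exact: key.
exists (F (sup S) v); split=> [|x Cx]; first by rewrite F0// v0 orbT.
rewrite dotF; have [tx|tx|tx] := ltgtP (t x) 0.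
- have : sup S <= dot v (D x) / - t x.
    by apply: ge_sup => // _ [y [Cy ty] <-]; exact: key.
  rewrite ler_pdivlMr ?oppr_gt0//; lra.
- have : - dot v (D x) / t x <= sup S.
    by apply: sup_upper_bound => //; exists x.
  rewrite ler_pdivrMr//; lra.
- by rewrite tx mulr0 add0r; apply: vC; rewrite /C' /= tDE.
Qed.

(** Families are flattened into vectors of dimension [n * d]; the separating functional then splits
    into one row per member. *)
Lemma weak_separation_family n d (C : set ('I_n -> 'cV[R]_d)) :
  (forall x y t, C x -> C y -> 0 <= t <= 1 ->
     C (fun i => (1 - t) *: x i + t *: y i)) ->
  C !=set0 -> ~ C (fun=> 0) ->
  exists u : 'I_n -> 'rV[R]_d, (exists i, u i != 0) /\
    forall x, C x -> 0 <= \sum_i dot (u i) (x i).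
Proof.
move=> cC [x0 Cx0] C0.
pose dec (z : 'cV[R]_(n * d)) i : 'cV[R]_d := (row i (vec_mx z^T))^T.
pose enc (x : 'I_n -> 'cV[R]_d) : 'cV[R]_(n * d) :=
  (mxvec (\matrix_(i, j) x i j 0))^T.
have encK x : dec (enc x) = x.
  apply/funext => i; apply/matrixP => j k.
  by rewrite /dec /enc trmxK mxvecK !mxE ord1.
have [|||u [u0 uC]] := @weak_separation _ [set z | C (dec z)].
- move=> x y t /= Cx Cy t01.
  rewrite (_ : dec _ = (fun i => (1 - t) *: dec x i + t *: dec y i)).
    exact: cC.
  by apply/funext => i; rewrite /dec !linearD/= !linearZ/=.
- by exists (enc x0); rewrite /= encK.
- rewrite /= (_ : dec 0 = (fun=> 0))//.
  by apply/funext => i; rewrite /dec !linear0.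
have uE (x : 'I_n -> 'cV[R]_d) :
    dot u (enc x) = \sum_i dot (row i (vec_mx u)) (x i).
  rewrite dotE (reindex _ (curry_mxvec_bij n d))/=.
  under [RHS]eq_bigr do rewrite dotE.
  rewrite pair_big/=; apply: eq_bigr => -[i j] _ /=.
  by rewrite /enc mxE mxvecE !mxE.
exists (fun i => row i (vec_mx u)); split; last first.
  by move=> x Cx; rewrite -uE; apply: uC; rewrite /= encK.
apply: contrapT => /forallNP u00; case/eqP: u0.
apply: (can_inj vec_mxK); rewrite linear0; apply/row_matrixP => i.
by rewrite row0; apply/eqP; rewrite -[_ == _]negbK; apply/negP/u00.
Qed.

End Separation.

(** * Interiors of convex sets and supporting half-spaces *)

Section Interior.
Variables (R : realType) (d : nat).
Notation pt := 'cV[R]_d.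
Implicit Types (K C : set pt) (u : 'rV[R]_d).

Lemma ballP (x : pt) e y : ball x e y <-> `|x - y| < e.
Proof. by rewrite -ball_normE. Qed.

Lemma interior_normP K x :
  K° x <-> exists2 e : R, 0 < e & forall r, `|r| < e -> K (x + r).
Proof.
rewrite /interior -nbhs_ballE; split=> [[e /= e0 H]|[e e0 H]]; exists e => //=.
  by move=> r re; apply: H; apply/ballP; rewrite opprD addNKr normrN.
by move=> y /ballP; rewrite distrC => /H; rewrite addrC subrK.
Qed.

(** A perturbation [r] of the combination is absorbed by the interior point, as a perturbation of
    [y] by [r / t]. *)
Lemma interior_convex_comb K x y t : convex_set K ->
  K x -> K° y -> 0 < t <= 1 -> K° ((1 - t) *: x + t *: y).
Proof.
move=> cK Kx /interior_normP[e e0 H] /andP[t0 t1].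
apply/interior_normP; exists (t * e); first by rewrite mulr_gt0.
move=> r re; rewrite -addrA.
have -> : t *: y + r = t *: (y + t^-1 *: r).
  by rewrite scalerDr scalerA divff ?gt_eqF// scale1r.
apply: cK => //; last by rewrite ltW.
by apply: H; rewrite normrZ gtr0_norm ?invr_gt0// mulrC ltr_pdivrMr// mulrC.
Qed.

Lemma convex_interior K : convex_set K -> convex_set K°.
Proof.
move=> cK x y t Kx Ky /andP[]; rewrite le_eqVlt => /orP[/eqP <- _|t0 t1].
  by rewrite subr0 scale1r scale0r addr0.
by apply: interior_convex_comb; rewrite ?t0//; exact: interior_subset.
Qed.

(** A point of [K] violating the bound could be moved slightly towards [x0], becoming interior while
    still violating it. *)
Lemma halfspace_extend K u c x0 : convex_set K -> K° x0 ->
  (forall x, K° x -> c <= dot u x) -> forall x, K x -> c <= dot u x.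
Proof.
move=> cK Kx0 H x Kx; rewrite leNgt; apply/negP => ux.
have c0 := H _ Kx0.
pose D := dot u x0 - dot u x.
have D0 : 0 < D by rewrite subr_gt0 (lt_le_trans ux).
(* With this [t] the value of [dot u] at the moved point is midway between [dot u x] and [c], hence
   below [c]. *)
pose t := (c - dot u x) / (2 * D).
have t0 : 0 < t.
  by apply: divr_gt0; [rewrite subr_gt0|exact: mulr_gt0].
have t1 : t <= 1 by rewrite ler_pdivrMr ?mulr_gt0// mul1r /D; lra.
have := H _ (interior_convex_comb cK Kx Kx0 (introT andP (conj t0 t1))).
rewrite dotDr !dotZr.
have -> : (1 - t) * dot u x + t * dot u x0 = dot u x + t * D by rewrite /D; ring.
have -> : t * D = (c - dot u x) / 2 by rewrite /t; field; rewrite gt_eqF.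
by lra.
Qed.

Lemma halfspace_interior K u c x : u != 0 ->
  (forall x, K x -> c <= dot u x) -> K° x -> c < dot u x.
Proof.
move=> u0 H /interior_normP[e e0 Kx].
have u1 := dot_trmx_gt0 u0.
(* Small enough for a step of [- t] along [u^T] to stay within distance [e]; the added 1 keeps the
   divisor visibly positive. *)
pose t := e / (2 * (1 + `|u^T|)).
have n0 : 0 < 1 + `|u^T| by rewrite ltr_wpDr.
have t0 : 0 < t by rewrite divr_gt0// mulr_gt0.
have /H : K (x + (- t) *: u^T).
  apply: Kx; rewrite normrZ normrN gtr0_norm// /t mulrAC ltr_pdivrMr ?mulr_gt0//.
  by rewrite ltr_pM2l//; have := normr_ge0 u^T; lra.
rewrite dotDr dotZr mulNr => /le_lt_trans; apply.
by rewrite gtrBl mulr_gt0.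
Qed.

Lemma separate_point K (p : pt) x0 : convex_set K -> K° x0 -> ~ K° p ->
  exists2 u, u != 0 & forall x, K x -> dot u p <= dot u x.
Proof.
move=> cK Kx0 Kp.
have [|||u [u0 uC]] := @weak_separation R d [set z | K° (z + p)].
- move=> x y t /= Kx Ky t01; have := convex_interior cK Kx Ky t01.
  by rewrite !scalerDr addrACA -scalerDl subrK scale1r.
- by exists (x0 - p); rewrite /= subrK.
- by rewrite /= add0r.
exists u => //; apply: (halfspace_extend cK Kx0) => x Kx.
rewrite -subr_ge0 -dotBr; apply: uC; by rewrite /= subrK.
Qed.

(* Separating the product of the translates [K° - q i] from the diagonal gives
   normals [u i] with zero sum, so that the translation [b] cancels below. *)
Lemma separate_translates n (q : 'I_n -> pt) K x0 :
  convex_set K -> K° x0 ->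
  (forall u, exists c, forall x, K x -> c <= dot u x) ->
  (forall b, exists i, ~ K° (q i + b)) ->
  exists G : seq ('rV[R]_d * R),
    (forall g, g \in G -> g.1 != 0 /\ forall x, K x -> g.2 <= dot g.1 x) /\
    forall b, exists i g, g \in G /\ dot g.1 (q i + b) <= g.2.
Proof.
move=> cK Kx0 Kbd Kq.
pose D := [set y : 'I_n -> pt | exists b, forall i, K° (y i + q i + b)].
have [|||u [[i0 ui0] uD]] := @weak_separation_family R n d D.
- move=> x y t [b Hb] [b' Hb'] t01; exists ((1 - t) *: b + t *: b') => i.
  have -> : (1 - t) *: x i + t *: y i + q i + ((1 - t) *: b + t *: b') =
      (1 - t) *: (x i + q i + b) + t *: (y i + q i + b').
    by apply/matrixP => j k; rewrite !mxE; ring.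
  exact: (convex_interior cK).
- exists (fun i => x0 - q i), 0 => i; by rewrite subrK addr0.
- move=> [b Hb]; have [i] := Kq b; apply; by have := Hb i; rewrite add0r.
(* If the sum [v] were nonzero, the shift [t *: v^T] could be undone by the free translation in [D],
   while [t] is chosen to make the functional negative. *)
have sum_u : \sum_i u i = 0.
  apply/eqP; apply: contrapT => /negP v0; set v := \sum_i u i in v0.
  have vv := dot_trmx_gt0 v0.
  pose y0 := \sum_i dot (u i) (x0 - q i).
  pose t := (1 + `|y0|) / dot v v^T.
  have : D (fun i => x0 - q i - t *: v^T).
    by exists (t *: v^T) => i; rewrite addrAC subrK subrK.
  move/uD; under eq_bigr do rewrite dotBr.
  rewrite sumrB -/y0.
  have -> : \sum_i dot (u i) (t *: v^T) = t * dot v v^T.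
    under eq_bigr do rewrite dotZr; rewrite -mulr_sumr; congr (_ * _).
    by rewrite /v /dot mulmx_suml summxE.
  rewrite /t divfK ?gt_eqF//; have := ler_norm y0; lra.
have uq (b : pt) : \sum_i dot (u i) (q i + b) = \sum_i dot (u i) (q i).
  under eq_bigr do rewrite dotDr; rewrite big_split/=.
  rewrite [X in _ + X](_ : _ = 0) ?addr0//.
  by rewrite /dot -summxE -mulmx_suml sum_u mul0mx mxE.
pose S i := [set dot (u i) x | x in K°].
have iS i : has_inf (S i).
  split; first by exists (dot (u i) x0), x0.
  have [c Hc] := Kbd (u i); exists c => _ [x Kx <-].
  exact: Hc (interior_subset Kx).
pose c i := inf (S i).
have cP i x : K x -> c i <= dot (u i) x.
  apply: (halfspace_extend cK Kx0) => z Kz.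
  by apply: ge_inf; [exact: (iS i).2|exists z].
have sumc : \sum_i dot (u i) (q i) <= \sum_i c i.
  apply/ler_addgt0Pr => e e0.
  have en : 0 < e / n.+1%:R by rewrite divr_gt0.
  (* Near-minimisers [k i] yield the member [k i - q i] of [D], with translation 0. The errors add
     up to at most [e]; [n.+1] keeps each of them positive even for [n = 0]. *)
  have /choice[k Hk] i : exists z, K° z /\ dot (u i) z < c i + e / n.+1%:R.
    by have [_ [z Kz <-] H] := inf_adherent en (iS i); exists z.
  have /uD : D (fun i => k i - q i).
    by exists 0 => i; rewrite subrK addr0; exact: (Hk i).1.
  under eq_bigr do rewrite dotBr.
  rewrite sumrB subr_ge0 => /le_trans; apply.
  apply: (@le_trans _ _ (\sum_i (c i + e / n.+1%:R))).
    by apply: ler_sum => i _; exact/ltW/(Hk i).2.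
  rewrite big_split/= lerD2l sumr_const card_ord -[leLHS]mulr_natr mulrAC.
  by rewrite ler_pdivrMr// ler_pM2l// ler_nat.
exists [seq (u i, c i) | i <- enum 'I_n & u i != 0]; split.
  move=> g /mapP[i]; rewrite mem_filter => /andP[ui _] ->; split=> [|x] /=.
    exact: ui.
  exact: cP.
move=> b; apply: contrapT => /forallNP H.
suff : \sum_i c i < \sum_i dot (u i) (q i + b) by rewrite uq ltNge sumc.
have lt i : u i != 0 -> c i < dot (u i) (q i + b).
  move=> ui; rewrite ltNge; apply/negP => le; apply: (H i).
  exists (u i, c i); split=> //; apply/mapP; exists i => //.
  by rewrite mem_filter ui mem_enum.
(* The nonzero normal [u i0] makes the sum inequality strict; indices with zero normal contribute
   only a weak one. *)
rewrite (bigD1 i0)//= [ltRHS](bigD1 i0)//=; apply: ltr_leD; first exact: lt.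
apply: ler_sum => i _; have [ui|ui] := eqVneq (u i) 0; last exact/ltW/lt.
have := cP i _ (interior_subset Kx0); by rewrite ui /dot !mul0mx.
Qed.

End Interior.

(** * Bounded sets, enclosing polytopes, and finiteness of bounded integer matrices *)

Section Bounds.
Variables (R : realType) (d : nat).
Notation pt := 'cV[R]_d.
Implicit Types (K X : set pt) (N : R).

Lemma compact_coord_bounded K : compact K ->
  exists N : R, 0 < N /\ forall x, K x -> forall i, `|x i 0| <= N.
Proof.
move=> /compact_bounded[M [Mr HM]].
exists (`|M| + 2); split=> [|x Kx i]; first by have := normr_ge0 M; lra.
have xM : `|x| <= `|M| + 1.
  by apply: HM => //; have := ler_norm M; lra.
have /(ballP 0 (`|M| + 2) x)[_ /(_ i 0)] : `|0 - x| < `|M| + 2.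
  by rewrite sub0r normrN; lra.
by rewrite mxE => /ltW; rewrite sub0r normrN.
Qed.

Lemma dot_bounded_below K (u : 'rV[R]_d) :
  compact K -> exists c, forall x, K x -> c <= dot u x.
Proof.
move=> /compact_coord_bounded[N [N0 KN]].
exists (- \sum_i `|u 0 i| * N) => x Kx.
rewrite lerNl dotE -sumrN; apply: ler_sum => i _.
rewrite (le_trans (ler_norm _))// normrN normrM ler_wpM2l//; exact: KN.
Qed.

(** The box lies in the cross-polytope of radius [d * N]: a point is the average of [d] points on
    the axes, each being [d] times one of its coordinate components. *)
Lemma box_in_conv_seq N : 0 < N ->
  exists s : seq pt, forall x : pt, (forall i, `|x i 0| <= N) -> conv_seq s x.
Proof.
move=> N0; pose L := d%:R * N; pose e i : pt := delta_mx i 0.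
exists (0 :: [seq L *: e i | i <- enum 'I_d] ++
        [seq - L *: e i | i <- enum 'I_d]) => x xN.
set s := _ :: _.
(* In dimension 0 the averaging fails, but the space is the single point 0, listed explicitly in the
   sequence. *)
have [d0|d0] := posnP d.
  apply: conv_seq_mem; rewrite (_ : x = 0) ?mem_head//.
  by apply/matrixP => i; have := ltn_ord i; rewrite {2}d0.
have dp : 0 < d%:R :> R by rewrite ltr0n.
have L0 : 0 < L by rewrite mulr_gt0.
have -> : x = \sum_i d%:R^-1 *: ((d%:R * x i 0) *: e i).
  apply/matrixP => j k; rewrite ord1 summxE (bigD1 j)//= big1 ?addr0.
    by rewrite !mxE !eqxx mulr1 mulrA mulVf ?mul1r// gt_eqF.
  by move=> i /negbTE ij; rewrite !mxE eq_sym ij !mulr0.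
apply: convex_sum => [|i||i _].
- exact: convex_conv_seq.
- by rewrite invr_ge0 ltW.
- by rewrite sumr_const card_ord -[LHS]mulr_natr mulVf// gt_eqF.
have sL : conv_seq s (L *: e i).
  apply: conv_seq_mem; rewrite in_cons mem_cat; apply/orP; right.
  by apply/orP; left; apply: map_f; rewrite mem_enum.
have sNL : conv_seq s (- L *: e i).
  apply: conv_seq_mem; rewrite in_cons mem_cat; apply/orP; right.
  by apply/orP; right; apply: (map_f (fun i => - L *: e i)); rewrite mem_enum.
pose t := (x i 0 + N) / (2 * N).
have -> : (d%:R * x i 0) *: e i = (1 - t) *: (- L *: e i) + t *: (L *: e i).
  rewrite !scalerA -scalerDl; congr (_ *: _).
  by rewrite /t /L; field; rewrite gt_eqF.
have := xN i; rewrite ler_norml => /andP[xl xu].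
apply: convex_conv_seq => //; apply/andP; split.
  by rewrite divr_ge0//; lra.
by rewrite ler_pdivrMr; lra.
Qed.

Lemma affine_comb (M : 'M[R]_d) (b : pt) n (p : 'I_n -> pt) (w : 'I_n -> R) :
  \sum_i w i = 1 ->
  M *m (\sum_i w i *: p i) + b = \sum_i w i *: (M *m p i + b).
Proof.
move=> w1; under [RHS]eq_bigr do rewrite scalerDr.
rewrite big_split/= -scaler_suml w1 scale1r mulmx_sumr; congr (_ + _).
by apply: eq_bigr => i _; rewrite scalemxAr.
Qed.

(** Each point [z] is an affine combination of points of [X], so a bound on the image of [X] bounds
    the image of [z], up to the sum of the absolute weights. Taking for [z] the origin bounds [b];
    the basis vectors then bound the columns of [M]. *)
Lemma affine_map_bounded X N : full_dimensional X ->
  exists B : R, forall (M : 'M[R]_d) (b : pt),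
    (forall x, X x -> forall i, `|(M *m x + b) i 0| <= N) ->
    (forall i j, `|M i j| <= B) /\ (forall i j, `|b i j| <= B).
Proof.
move=> fX.
have /choice[c Hc] (z : pt) : exists c, 0 <= c /\ forall (M : 'M[R]_d) (b : pt),
    (forall x, X x -> forall i, `|(M *m x + b) i 0| <= N) ->
    forall i, `|(M *m z + b) i 0| <= c * `|N|.
  have : aff_hull X z by rewrite fX.
  move=> [n [p [w [Xp [w1 zE]]]]]; exists (\sum_i `|w i|).
  split=> [|M b H i]; first exact: sumr_ge0.
  rewrite zE affine_comb//.
  rewrite summxE (le_trans (ler_norm_sum _ _ _))// mulr_suml.
  apply: ler_sum => k _; rewrite mxE normrM ler_wpM2l//.
  exact: le_trans (H _ (Xp k) i) (ler_norm _).
pose e j : pt := delta_mx j 0.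
have S0 : 0 <= \sum_j c (e j) * `|N|.
  by apply: sumr_ge0 => j _; rewrite mulr_ge0//; exact: (Hc _).1.
exists (\sum_j c (e j) * `|N| + c 0 * `|N|) => M b H.
have bB i : `|b i 0| <= c 0 * `|N|.
  by have := (Hc 0).2 M b H i; rewrite mulmx0 add0r.
split=> i j; last by rewrite [j]ord1 (le_trans (bB i))// lerDr.
have -> : M i j = (M *m e j + b) i 0 - b i 0.
  rewrite mxE addrK mxE (bigD1 j)//= big1 ?addr0 => [|k /negbTE kj].
    by rewrite mxE !eqxx mulr1.
  by rewrite mxE kj mulr0.
rewrite (le_trans (ler_normB _ _))// lerD//.
rewrite (le_trans ((Hc (e j)).2 M b H i))//.
rewrite [leRHS](bigD1 j)//= lerDl sumr_ge0// => k _.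
by rewrite mulr_ge0//; exact: (Hc _).1.
Qed.

Lemma int_mx_bounded_finite p q (B : R) :
  exists (F : finType) (f : F -> 'M[int]_(p, q)),
    forall M : 'M[int]_(p, q),
      (forall i j, `|(M i j)%:~R : R| <= B) -> exists k, M = f k.
Proof.
pose n := Num.bound B.
(* Shifting by [n] lets the [2n + 1] ordinals stand for the integers from [-n] to [n]. *)
pose dec (k : 'I_(n + n).+1) : int := k%:Z - n%:Z.
exists ('M['I_(n + n).+1]_(p, q) : finType), (map_mx dec) => M MB.
exists (map_mx (fun z : int => inord `|(z + n%:Z)%R|%N) M).
apply/matrixP => i j; rewrite !mxE /dec.
have : (`|M i j|%:~R : R) < n%:Z%:~R.
  rewrite intr_norm; apply: le_lt_trans (MB i j) _.
  exact: unstable.ltr_bound.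
rewrite ltr_int => Mn.
rewrite inordK; lia.
Qed.

End Bounds.

(** * Free and maximal free bodies *)

Section Freeness.
Variables (R : realType) (d : nat).
Notation pt := 'cV[R]_d.
Implicit Types (X K L : set pt) (A : coeffA).

Lemma aff_hull_interior K x0 : K° x0 -> aff_hull K = setT.
Proof.
move=> /interior_normP[e e0 Ke]; apply/seteqP; split=> // z _.
pose r := z - x0.
have n0 : 0 < 1 + `|r| by rewrite ltr_wpDr.
pose t := e / (1 + `|r|).
have t0 : 0 < t by rewrite divr_gt0.
(* [z] lies on the line through [x0] and the nearby point [x0 + t *: r] of [K], at parameter
   [t^-1]. *)
exists 2%N, (fun i => if i == 0 then x0 else x0 + t *: r),
  (fun i => if i == 0 then 1 - t^-1 else t^-1).
rewrite !big_ord_recl !big_ord0/= !addr0; split; last split.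
- move=> i; case: ifP => _.
    by rewrite -[x0]addr0; apply: Ke; rewrite normr0.
  apply: Ke; rewrite normrZ gtr0_norm// /t mulrAC ltr_pdivrMr// ltr_pM2l//.
  by rewrite ltrDr.
- by rewrite subrK.
- rewrite scalerDr scalerA mulVf ?gt_eqF// scale1r addrA -scalerDl subrK.
  by rewrite scale1r /r addrC subrK.
Qed.

Lemma relint_full_dimensional K : full_dimensional K -> relint K = K°.
Proof.
move=> fK; apply/seteqP; split=> x.
  by move=> [Kx [e [e0]]]; rewrite fK setIT => H; apply/nbhs_ballP; exists e.
move=> Kx; split; first exact: interior_subset Kx.
by move/nbhs_ballP: Kx => [e /= e0 H]; exists e; rewrite fK setIT.
Qed.

Lemma unimodular_mapP A (T : pt -> pt) : unimodular_map A T ->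
  exists (M : 'M[int]_d) (b : pt),
    [/\ M \in unitmx, map_mx intr M \in @unitmx R d,
        (forall i j, inA A (b i j)) & T = fun x => map_mx intr M *m x + b].
Proof.
move=> [M [b [uM [Ab TE]]]]; exists M, b; split=> //.
  by rewrite unitmxE det_map_mx rmorph_unit// -unitmxE.
exact/funext.
Qed.

Lemma full_dimensional_copy A X Y :
  full_dimensional X -> unimodular_copy A X Y -> full_dimensional Y.
Proof.
move=> fX [T [/unimodular_mapP[M [b [_ uM _ ->]]] ->]].
apply/seteqP; split=> // z _.
have : aff_hull X (invmx (map_mx intr M) *m (z - b)) by rewrite fX.
move=> [n [p [w [Xp [w1 zE]]]]].
exists n, (fun i => map_mx intr M *m p i + b), w; split.
  by move=> i; exists (p i).
split=> //; rewrite -affine_comb// -zE mulmxA mulmxV// mul1mx subrK//.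
Qed.

Lemma aff_hull_sub K L : K `<=` L -> aff_hull K `<=` aff_hull L.
Proof. by move=> KL x [n [p [w [Kp H]]]]; exists n, p, w; split=> // i; apply: KL. Qed.

(** A copy of [X] inside [L] would make [L] full-dimensional, so its relative interior would be its
    interior, which is empty. *)
Lemma empty_interior_free A X L : X !=set0 -> full_dimensional X ->
  L° = set0 -> AX_free A X L.
Proof.
move=> [x Xx] fX L0 [Y [cY YL]].
have fL : full_dimensional L.
  apply/seteqP; split=> //; rewrite -(full_dimensional_copy fX cY).
  by apply: aff_hull_sub => y /YL[].
have [T [_ YE]] := cY; have : relint L (T x) by apply: YL; rewrite YE; exists x.
by rewrite relint_full_dimensional// L0.
Qed.

(* Doubling [K] about one of its points keeps the interior empty, so a maximal
   free body with empty interior equals its double and is a single point. *)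
Lemma maximal_empty_interior A X K : X !=set0 -> full_dimensional X ->
  maximal_AX_free_body A X K -> K° = set0 -> exists x0, K = [set x0].
Proof.
move=> X0 fX [[[x0 Kx0] [kK cK]] [_ maxK]] K0; exists x0.
pose L := [set 2%:R *: k - x0 | k in K].
have LK : L = K.
  apply: maxK.
  - split; first by exists (2%:R *: x0 - x0), x0.
    split.
      apply: continuous_compact => //; apply: continuous_subspaceT => x.
      exact: (cvgB (@scaler_continuous R pt 2%:R x) (cvg_cst x0)).
    move=> _ _ t [x Kx <-] [y Ky <-] t01.
    exists ((1 - t) *: x + t *: y); first exact: cK.
    by apply/matrixP => i j; rewrite !mxE; ring.
  - apply: empty_interior_free => //; rewrite -subset0 => y.
    move=> /interior_normP[e e0 Le]; suff : K° (2%:R^-1 *: (y + x0)) by rewrite K0.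
    apply/interior_normP; exists (e / 2) => [|r re]; first by rewrite divr_gt0.
    have /Le[k Kk kE] : `|2%:R *: r| < e.
      by rewrite normrZ ger0_norm// mulrC -ltr_pdivlMr.
    suff -> : 2%:R^-1 *: (y + x0) + r = k by [].
    have -> : y = 2%:R *: k - x0 - 2%:R *: r by rewrite kE addrK.
    by apply/matrixP => i j; rewrite !mxE; field.
  - move=> k Kk; exists (2%:R^-1 *: (k + x0)).
      have -> : 2%:R^-1 *: (k + x0) = (1 - 2%:R^-1) *: x0 + 2%:R^-1 *: k.
        by apply/matrixP => i j; rewrite !mxE; field.
      apply: cK => //; apply/andP; split; lra.
    by apply/matrixP => i j; rewrite !mxE; field.
apply/seteqP; split=> [k Kk|_ ->//]; apply/matrixP => i j; rewrite ord1 {j}.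
have [N [N0 KN]] := compact_coord_bounded kK.
(* Doubling maps [K] onto itself and doubles distances to [x0] in each coordinate, which forces
   their supremum to be 0. *)
pose S := [set `|k i 0 - x0 i 0| | k in K].
have hS : has_sup S.
  split; first by exists `|x0 i 0 - x0 i 0|, x0.
  exists (N + N) => _ [x Kx <-].
  by rewrite (le_trans (ler_normB _ _))// lerD// KN.
have S2 x : K x -> 2 * `|x i 0 - x0 i 0| <= sup S.
  move=> Kx; apply: sup_upper_bound => //; exists (2%:R *: x - x0).
    by rewrite -LK; exists x.
  rewrite !mxE -[2 in RHS]ger0_norm// -normrM; congr `|_|; ring.
have : sup S <= sup S / 2.
  apply: ge_sup; first exact: hS.1.
  by move=> _ [x Kx <-]; have := S2 _ Kx; lra.
have := S2 _ Kk; have := normr_ge0 (k i 0 - x0 i 0) => n0 H1 H2.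
have : `|k i 0 - x0 i 0| = 0 by lra.
by move/eqP; rewrite normr_eq0 subr_eq0 => /eqP.
Qed.

(** Concatenates the finite lists of half-spaces found for the finitely many classes [C k] of
    maps. *)
Lemma gather_finite (S : Type) (V : eqType) (good : V -> Prop)
    (hit : V -> S -> Prop) (F : finType) (C : F -> S -> Prop) :
  (forall k, exists G : seq V, (forall g, g \in G -> good g) /\
     forall T, C k T -> exists2 g, g \in G & hit g T) ->
  exists G : seq V, (forall g, g \in G -> good g) /\
    forall T k, C k T -> exists2 g, g \in G & hit g T.
Proof.
move=> /choice[G HG]; exists (flatten [seq G k | k <- enum F]); split.
  by move=> g /flattenP[_ /mapP[k _ ->]]; exact: (HG k).1.
move=> T k /(HG k).2[g gk hg]; exists g => //.
by apply/flattenP; exists (G k) => //; apply: map_f; rewrite mem_enum.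
Qed.

Lemma free_halfspaces A X K x0 N : polytope X -> full_dimensional X ->
  convex_set K -> compact K -> K° x0 ->
  (forall T, unimodular_map A T -> exists2 x, X x & ~ K° (T x)) ->
  exists G : seq ('rV[R]_d * R),
    (forall g, g \in G -> g.1 != 0 /\ forall x, K x -> g.2 <= dot g.1 x) /\
    forall T, unimodular_map A T ->
      (forall x, X x -> forall i, `|T x i 0| <= N) ->
      exists2 g, g \in G & exists2 x, X x & dot g.1 (T x) <= g.2.
Proof.
move=> [s [_ XE]] fX cK kK Kx0 Kfree.
have [B HB] := affine_map_bounded N fX.
have [F [f Ff]] := @int_mx_bounded_finite R d d B.
have [F' [f' Ff']] := @int_mx_bounded_finite R d 1 B.
pose good (g : 'rV[R]_d * R) := g.1 != 0 /\ forall x, K x -> g.2 <= dot g.1 x.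
pose hit (g : 'rV[R]_d * R) (T : pt -> pt) :=
  exists2 x, X x & dot g.1 (T x) <= g.2.
case: A Kfree => Kfree.
  (* Over the integers a class fixes both linear part and translation, so it holds at most one map
     and a single half-space suffices. Over the reals, below, only the linear part is fixed and all
     translations are treated together. *)
  pose C (k : F * F') (T : pt -> pt) := unimodular_map AZ T /\
    T = fun x => map_mx intr (f k.1) *m x + map_mx intr (f' k.2).
  have [|G [Ggood Ghit]] := @gather_finite _ _ good hit _ C.
    move=> k; have [[T CT]|nT] := pselect (exists T, C k T); last first.
      by exists [::]; split=> // T CT; case: nT; exists T.
    have [x Xx Kx] := Kfree T CT.1.
    have [u u0 uK] := separate_point cK Kx0 Kx.
    exists [:: (u, dot u (T x))]; split=> [g|T' CT'].
      by rewrite mem_seq1 => /eqP ->.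
    exists (u, dot u (T x)); first by rewrite mem_seq1.
    by exists x => //=; have -> : T' = T by rewrite CT'.2 CT.2.
  exists G; split=> // T uT TN.
  have [M [b [_ _ Zb TE]]] := unimodular_mapP uT; rewrite TE in TN *.
  have [MB bB] := HB _ _ TN.
  have [k Mk] : exists k, M = f k by apply: Ff => i j; have := MB i j; rewrite mxE.
  have [b' bE] : exists b' : 'M[int]_(d, 1), b = map_mx intr b'.
    exists (\matrix_(i, j) Num.floor (b i j)); apply/matrixP => i j.
    by rewrite !mxE floorK//; exact: Zb.
  have [k' bk] : exists k', b' = f' k'.
    by apply: Ff' => i j; have := bB i j; rewrite bE mxE.
  by apply: (Ghit _ (k, k')); rewrite /C /= -Mk -bk -bE -TE.
pose C (k : F) (T : pt -> pt) := f k \in unitmx /\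
  exists b, T = fun x => map_mx intr (f k) *m x + b.
have [|G [Ggood Ghit]] := @gather_finite _ _ good hit _ C.
  move=> k; have [uM|nuM] := boolP (f k \in unitmx); last first.
    by exists [::]; split=> // T [uM]; rewrite uM in nuM.
  pose q (i : 'I_(size s)) := map_mx intr (f k) *m s`_i : pt.
  have [|b|G [Gg Gh]] := separate_translates (q := q) cK Kx0.
  - by move=> u; exact: dot_bounded_below.
  (* If some translate had all its vertices in the interior of [K], convexity would place the whole
     copy there. *)
  - apply: contrapT => /forallNP H.
    have [|x Xx] := Kfree (fun x => map_mx intr (f k) *m x + b).
      by exists (f k), b.
    case; move: x Xx; rewrite XE.
    apply: conv_seq_sub.
      move=> x y t /= Kx Ky t01.
      have := convex_interior cK Kx Ky t01.
      congr (K° _); rewrite mulmxDr -!scalemxAr !scalerDr addrACA -scalerDl.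
      by rewrite subrK scale1r.
    move=> x xs; have xi : (index x s < size s)%N by rewrite index_mem.
    have := H (Ordinal xi); rewrite /q /= nth_index// => /contrapT; exact.
  exists G; split=> // T [_ [b ->]].
  have [i [g [gG gb]]] := Gh b; exists g => //; exists s`_i => //.
  by rewrite XE; apply: conv_seq_mem; exact: mem_nth.
exists G; split=> // T uT TN.
have [M [b [uM _ _ TE]]] := unimodular_mapP uT.
have [MB bB] : (forall i j, `|(map_mx intr M : 'M[R]_d) i j| <= B) /\
   (forall i j, `|b i j| <= B) by apply: HB; rewrite TE in TN.
have [k Mk] : exists k, M = f k by apply: Ff => i j; have := MB i j; rewrite mxE.
by apply: (Ghit _ k); split; [|exists b]; rewrite -Mk.
Qed.

End Freeness.

(** * Assembly of the enclosing free polytope *)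

Theorem theorem1p2 (R : realType) (d : nat) (A : coeffA) (X K : set 'cV[R]_d) :
  polytope X -> full_dimensional X ->
  maximal_AX_free_body A X K -> polytope K.
Proof.
move=> pX fX mK; have [s [s0 XE]] := pX.
have X0 : X !=set0.
  by exists s`_0; rewrite XE; apply: conv_seq_mem; exact: mem_nth.
have [K0|/set0P[x0 Kx0]] := eqVneq K° set0.
  have [x0 ->] := maximal_empty_interior X0 fX mK K0.
  exists [:: x0]; split=> //; apply/seteqP; split=> [_ ->|].
    by apply: conv_seq_mem; rewrite mem_head.
  apply: conv_seq_sub => [_ _ t -> -> _|x]; last by rewrite mem_seq1 => /eqP.
  by rewrite -scalerDl subrK scale1r.
have [[_ [kK cK]] [freeK maxK]] := mK.
have fK := aff_hull_interior Kx0.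
have Kfree T : unimodular_map A T -> exists2 x, X x & ~ K° (T x).
  move=> uT; apply: contrapT => H; apply: freeK; exists (T @` X).
  split; first by exists T.
  rewrite relint_full_dimensional// => _ [x Xx <-].
  by apply: contrapT => nK; apply: H; exists x.
have [N [N0 KN]] := compact_coord_bounded kK.
have [b Hb] := @box_in_conv_seq R d N N0.
(* The bound [N'] is that of the enclosing polytope rather than of [K], since copies inside the cut
   polytope must be excluded. *)
have [N' [_ bN']] := compact_coord_bounded (@compact_conv_seq R d b).
have [G [Ggood Ghit]] := free_halfspaces N' pX fX cK kK Kx0 Kfree.
have [s' PE] := conv_seq_halfspaces b G.
have KP : K `<=` conv_seq s'.
  move=> x Kx; rewrite -PE; split=> [|g gG]; first by apply: Hb => i; exact: KN.
  exact: (Ggood g gG).2.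
exists s'; split.
  (* An empty [s'] would give weights whose empty sum is 1. *)
  rewrite lt0n; apply/eqP => s'0.
  have [w [_ [w1 _]]] := KP _ (interior_subset Kx0).
  by move: w w1; rewrite s'0 => w; rewrite big_ord0 => /eqP; rewrite eq_sym oner_eq0.
rewrite [RHS]maxK//.
  split; first by exists x0; exact: KP (interior_subset Kx0).
  by split; [exact: compact_conv_seq|exact: convex_conv_seq].
have fP : full_dimensional (conv_seq s').
  apply/seteqP; split=> //; rewrite -fK; exact: aff_hull_sub.
move=> [Y [[T [uT ->]] YP]].
have TP x : X x -> (conv_seq s')° (T x).
  by rewrite -relint_full_dimensional// => Xx; apply: YP; exists x.
have [|g gG [x Xx]] := Ghit T uT.
  move=> x /TP /interior_subset; rewrite -PE => -[bx _]; exact: bN'.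
(* Interior points of the cut polytope satisfy the inequality of [g] strictly, against the point [x]
   supplied by [Ghit]. *)
apply/negP; rewrite -ltNge.
apply: (halfspace_interior (Ggood g gG).1 _ (TP _ Xx)).
by rewrite -PE => y [_]; exact.
Qed.
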